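(* Let $T_2,T_3\in \mathcal{L}_A(\mathcal{H})$. Then for every $n\in\mathbb{N}$ (i.e. every integer $n\ge 1$), $$w_{\mathbb{A}}\left(\begin{bmatrix} 0 & T_2\\ T_3 & 0\end{bmatrix}\right)\geq \left[\max\left\{w_A((T_2T_3)^n),\ w_A((T_3T_2)^n)\right\}\right]^{\frac{1}{2n}}.$$
   Context: $\mathcal{H}$ is a complex Hilbert space with inner product $\langle\cdot,\cdot\rangle$, and $\mathcal{L}(\mathcal{H})$ is the algebra of bounded linear operators on $\mathcal{H}$. $A\in\mathcal{L}(\mathcal{H})$ is a fixed positive operator, i.e. $A=A^*$ and $\langle Ax,x\rangle\ge 0$ for all $x\in\mathcal{H}$ ($A$ need not be injective). Put $\langle x,y\rangle_A=\langle Ax,y\rangle$ and $\|x\|_A=\sqrt{\langle x,x\rangle_A}$ (a seminorm). $\mathcal{R}(\cdot)$ denotes the range, and $\mathcal{L}_A(\mathcal{H})=\{T\in\mathcal{L}(\mathcal{H}):\mathcal{R}(T^*A)\subseteq\mathcal{R}(A)\}$ (the operators admitting an $A$-adjoint, i.e. an $X\in\mathcal{L}(\mathcal{H})$ with $AX=T^*A$); it is a subalgebra of $\mathcal{L}(\mathcal{H})$. For $T\in\mathcal{L}_A(\mathcal{H})$ the $A$-numerical radius is $w_A(T)=\sup\{|\langle Tx,x\rangle_A| : x\in\mathcal{H},\ \|x\|_A=1\}$. $\mathbb{A}=\begin{bmatrix} A&0\\0&A\end{bmatrix}$ is the positive diagonal operator on $\mathcal{H}\oplus\mathcal{H}$,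 and $w_{\mathbb{A}}$ is the numerical radius defined in the same way with $(\mathcal{H}\oplus\mathcal{H},\mathbb{A})$ in place of $(\mathcal{H},A)$. *)

(* Defs.v *)
From HB Require Import structures.
From mathcomp Require Import all_boot all_order all_algebra.
From mathcomp Require Import complex.
From mathcomp Require Import ring lra.
From mathcomp Require Import all_classical all_reals all_analysis.

Set Implicit Arguments.
Unset Strict Implicit.
Unset Printing Implicit Defensive.

Import Order.TTheory GRing.Theory Num.Theory.
Import numFieldNormedType.Exports.

Local Open Scope classical_set_scope.
Local Open Scope ring_scope.
Local Open Scope complex_scope.

(* The inner product is linear in its first argument and conjugate-linear in
   its second one. *)
HB.mixin Record CompleteNormedModule_hasInner (R : realType) H
    & @CompleteNormedModule R[i] H := {
  inner : {dot H for @conjc R} ;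
  innerxx : forall x : H, (inner : H -> H -> R[i]) x x = `|x| ^+ 2
}.

#[short(type="hilbertType")]
HB.structure Definition Hilbert (R : realType) :=
  {H of CompleteNormedModule R[i] H & CompleteNormedModule_hasInner R H}.

(* The product H * K of MathComp-Analysis carries the maximum norm, which does
   not come from an inner product; [hsum H K] is a copy with the norm
   sqrt (`|x|^2 + `|y|^2). *)
Definition hsum (R : realType) (H K : hilbertType R) : Type := (H * K)%type.

Section HilbertSum.
Variables (R : realType) (H K : hilbertType R).

HB.instance Definition _ := GRing.Lmodule.copy (hsum H K) (H * K)%type.

Definition hsum_inner (x y : hsum H K) : R[i] :=
  inner x.1 y.1 + inner x.2 y.2.

Definition hsum_norm (x : hsum H K) : R[i] :=
  sqrtC (`|x.1| ^+ 2 + `|x.2| ^+ 2).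

Lemma hsum_norm_ge0 x : 0 <= hsum_norm x.
Proof. by rewrite sqrtC_ge0 addr_ge0 ?exprn_ge0. Qed.

Lemma hsum_norm_sqr x : hsum_norm x ^+ 2 = `|x.1| ^+ 2 + `|x.2| ^+ 2.
Proof. by rewrite sqrtCK. Qed.

Lemma hsum_norm_fst x : `|x.1| <= hsum_norm x.
Proof.
by rewrite -(ler_pXn2r (n := 2)) ?nnegrE ?hsum_norm_ge0// hsum_norm_sqr
  lerDl exprn_ge0.
Qed.

Lemma hsum_norm_snd x : `|x.2| <= hsum_norm x.
Proof.
by rewrite -(ler_pXn2r (n := 2)) ?nnegrE ?hsum_norm_ge0// hsum_norm_sqr
  lerDr exprn_ge0.
Qed.

Lemma hsum_norm_le x : hsum_norm x <= `|x.1| + `|x.2|.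
Proof.
rewrite -(ler_pXn2r (n := 2)) ?nnegrE ?hsum_norm_ge0 ?addr_ge0//.
by rewrite hsum_norm_sqr sqrrD addrAC lerDl mulrn_wge0// mulr_ge0.
Qed.

Lemma hsum_normZ (l : R[i]) (x : hsum H K) :
  hsum_norm (l *: x) = `|l| * hsum_norm x.
Proof.
by rewrite /hsum_norm/= !normrZ !exprMn -mulrDr sqrtCM ?nnegrE ?exprn_ge0
  ?addr_ge0 ?exprn_ge0// exprCK.
Qed.

Lemma hsum_norm0_eq0 x : hsum_norm x = 0 -> x = 0.
Proof.
move=> x0; rewrite [x]surjective_pairing [RHS](_ : _ = (0, 0))//.
apply: (congr2 pair); apply/eqP; rewrite -normr_le0 -x0.
- exact: hsum_norm_fst.
- exact: hsum_norm_snd.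
Qed.

Lemma hsum_normD x y : hsum_norm (x + y) <= hsum_norm x + hsum_norm y.
Proof.
rewrite -(ler_pXn2r (n := 2)) ?nnegrE ?addr_ge0 ?hsum_norm_ge0//.
rewrite sqrrD !hsum_norm_sqr/=.
set a := `|x.1|; set b := `|x.2|; set c := `|y.1|; set d := `|y.2|.
have [a0 b0 c0 d0] : [/\ 0 <= a, 0 <= b, 0 <= c & 0 <= d] by rewrite !normr_ge0.
have ar : a \is Num.real by rewrite ger0_real.
have br : b \is Num.real by rewrite ger0_real.
have cr : c \is Num.real by rewrite ger0_real.
have dr : d \is Num.real by rewrite ger0_real.
apply: (@le_trans _ _ ((a + c) ^+ 2 + (b + d) ^+ 2)).
  by rewrite lerD// ler_pXn2r ?nnegrE ?addr_ge0 ?ler_normD.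
have cs : a * c + b * d <= hsum_norm x * hsum_norm y.
  rewrite -(ler_pXn2r (n := 2)) ?nnegrE ?addr_ge0 ?mulr_ge0 ?hsum_norm_ge0//.
  rewrite exprMn !hsum_norm_sqr -/a -/b -/c -/d -subr_ge0.
  rewrite (_ : _ - _ = (a * d - b * c) ^+ 2); last by ring.
  by rewrite real_exprn_even_ge0// rpredB ?rpredM.
rewrite -subr_ge0 in cs.
rewrite -subr_ge0 (_ : _ - _ =
  (hsum_norm x * hsum_norm y - (a * c + b * d)) *+ 2); last by ring.
exact: mulrn_wge0.
Qed.

HB.instance Definition _ := Lmodule_isNormed.Build R[i] (hsum H K)
  hsum_normD hsum_normZ hsum_norm0_eq0.

Lemma hsum_complete (F : set_system (hsum H K)) :
  ProperFilter F -> cauchy F -> cvg F.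
Proof.
move=> FF /cauchy_ballP Fc.
have c1 : cvg ((fun x : hsum H K => x.1) @ F).
  apply: cauchy_cvg; apply/cauchy_ballP => e e0; near_simpl.
  have := Fc e e0; rewrite -!ball_normE; apply: filterS => -[p q] /=.
  by apply: le_lt_trans; exact: (hsum_norm_fst (p - q)).
have c2 : cvg ((fun x : hsum H K => x.2) @ F).
  apply: cauchy_cvg; apply/cauchy_ballP => e e0; near_simpl.
  have := Fc e e0; rewrite -!ball_normE; apply: filterS => -[p q] /=.
  by apply: le_lt_trans; exact: (hsum_norm_snd (p - q)).
move/cvg_ex: c1 => -[l1 /cvgrPdist_lt l1P].
move/cvg_ex: c2 => -[l2 /cvgrPdist_lt l2P].
apply/cvg_ex; exists ((l1, l2) : hsum H K).
apply/(@cvgrPdist_lt _ _ _ F FF idfun) => e e0.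
have e20 : 0 < e / 2 by rewrite divr_gt0.
move: (l1P _ e20) (l2P _ e20); apply: filterS2 => x x1 x2.
apply: (le_lt_trans (hsum_norm_le _)).
by rewrite [e]splitr ltrD.
Qed.

HB.instance Definition _ := Uniform_isComplete.Build (hsum H K) hsum_complete.

Lemma hsum_inner_bilinear :
  bilinear_for *%R (@conjc R \; *%R) hsum_inner.
Proof.
split=> [u a v w|u a v w]; rewrite /hsum_inner/=.
  by rewrite !linearPl/=; ring.
by rewrite !linearPr/=; ring.
Qed.

HB.instance Definition _ := bilinear_isBilinear.Build R[i]
  (hsum H K) (hsum H K) R[i] *%R (@conjc R \; *%R) hsum_inner
  hsum_inner_bilinear.

Lemma hsum_inner_hermitian (x y : hsum H K) :
  hsum_inner x y = (-1) ^+ false * conjc (hsum_inner y x).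
Proof.
rewrite expr0 mul1r /hsum_inner rmorphD/=.
by rewrite (hermitian_subproof x.1) (hermitian_subproof x.2) !expr0 !mul1r.
Qed.

HB.instance Definition _ := isHermitianSesquilinear.Build R[i] (hsum H K)
  false (@conjc R) hsum_inner hsum_inner_hermitian.

Lemma hsum_innerxx (x : hsum H K) : hsum_inner x x = `|x| ^+ 2.
Proof. by rewrite [RHS]hsum_norm_sqr /hsum_inner !innerxx. Qed.

Lemma hsum_inner_gt0 (x : hsum H K) : x != 0 -> 0 < hsum_inner x x.
Proof. by move=> x0; rewrite hsum_innerxx exprn_gt0// normr_gt0. Qed.

HB.instance Definition _ := isDotProduct.Build R[i] (hsum H K)
  hsum_inner hsum_inner_gt0.

HB.instance Definition _ := CompleteNormedModule_hasInner.Build R (hsum H K)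
  hsum_innerxx.

End HilbertSum.

Section Operators.
Variables (R : realType) (H : hilbertType R).
Implicit Types A T S : H -> H.

Definition bounded_op T := exists M : R, forall x, `|T x| <= M%:C * `|x|.

Definition is_adjoint T S := forall x y : H, inner (T x) y = inner x (S y).

(* T^*: by the Riesz representation theorem the set below is a singleton when T
   is linear and bounded; [adjoint T] is only meaningful for such T. *)
Definition adjoint T : H -> H := get [set S | is_adjoint T S].

Definition positive_op A :=
  [/\ bounded_op A, A = adjoint A & forall x, 0 <= inner (A x) x].

Definition LA A T := bounded_op T /\ range (adjoint T \o A) `<=` range A.

Definition innerA A (x y : H) : R[i] := inner (A x) y.

(* For a positive A, innerA A x x is real and nonnegative, so taking its real
   part loses nothing. *)
Definition normA A (x : H) : R := Num.sqrt (complex.Re (innerA A x x)).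

(* The set of values is bounded when A is positive and T is in LA A. It is
   empty when A = 0, and then wA A T = sup set0 = 0. The complex modulus `|z|
   has type R[i]; its real part is the modulus as an element of R. *)
Definition wA A T : R :=
  sup [set complex.Re `|innerA A (T x) x| | x in [set x | normA A x = 1]].

End Operators.

Definition opmx (R : realType) (H : hilbertType R) (T11 T12 T21 T22 : H -> H)
    (x : hsum H H) : hsum H H :=
  (T11 x.1 + T12 x.2, T21 x.1 + T22 x.2).

(* Main.v *)
Require Import Defs.
From HB Require Import structures.
From mathcomp Require Import all_boot all_order all_algebra.
From mathcomp Require Import complex.
From mathcomp Require Import cyclic separable cyclotomic.
From mathcomp Require Import ring lra.
From mathcomp Require Import all_classical all_reals all_analysis.

Import Order.TTheory GRing.Theory Num.Theory.
Import numFieldNormedType.Exports.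

Local Open Scope classical_set_scope.
Local Open Scope ring_scope.

(* With T the off-diagonal operator, T^(2n) is block diagonal with blocks
   (T2 T3)^n and (T3 T2)^n, so the theorem is the power inequality
   w(T^m) <= w(T)^m of Berger, in the form given by Pearcy's proof, for the
   semi-inner product of diag(A, A).  The proof also needs the supremum w(T) to
   be finite, i.e. an operator of L_A(H) to be bounded for the A-seminorm.  From
   A X = T^* A (where T^* exists by Riesz), the functionals <., A T v> with
   |A v| <= 1 are pointwise bounded, so |A T v| <= C |A v| by the uniform
   boundedness principle.  Boundedness for |.| and for |A .| interpolates to
   boundedness for |.|_A: with S = X T the sequence |S^j x|_A^2 is log-convex
   and grows at most geometrically, which bounds |S x|_A and hence |T x|_A. *)

(** * Semi-inner products and the Cauchy-Schwarz inequality *)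

Section SemiInner.
Local Open Scope complex_scope.
Set Implicit Arguments.
Unset Strict Implicit.
Variables (R : realType) (V : lmodType R[i]).

Lemma Re_ge0 (z : R[i]) : 0 <= z -> 0 <= complex.Re z.
Proof. by rewrite lecE => /andP[_]. Qed.

Lemma Re_normr (z : R[i]) : (complex.Re `|z|)%:C = `|z|.
Proof. by rewrite normc_def. Qed.

Lemma Re_normr_sqr (z : R[i]) : ((complex.Re `|z|) ^+ 2)%:C = z * conjc z.
Proof. by rewrite -sqr_normc -[in RHS]Re_normr rmorphXn. Qed.

Lemma Re_le_normr (z : R[i]) : complex.Re z <= complex.Re `|z|.
Proof.
rewrite -lecR Re_normr; apply: le_trans (normc_ge_Re z).
by rewrite lecR ler_norm.
Qed.

Lemma cReD (a b : R[i]) : complex.Re (a + b) = complex.Re a + complex.Re b.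
Proof. by case: a; case: b. Qed.

Lemma cReB (a b : R[i]) : complex.Re (a - b) = complex.Re a - complex.Re b.
Proof. by case: a; case: b. Qed.

Lemma cReMr (t : R) (a : R[i]) : complex.Re (t%:C * a) = t * complex.Re a.
Proof. by case: a => b c /=; rewrite mul0r subr0. Qed.

Lemma conjcNMr (t : R) (z : R[i]) : conjc (- (t%:C * z)) = - (t%:C * conjc z).
Proof. by case: z => b c; rewrite /conjc /=; simpc. Qed.

Definition semi_inner (h : V -> V -> R[i]) :=
  [/\ forall a x y z, h (a *: x + y) z = a * h x z + h y z,
      forall x y, h y x = conjc (h x y) & forall x, 0 <= h x x].

Variable h : V -> V -> R[i].
Hypothesis hS : semi_inner h.

Lemma sinn_sym x y : h y x = conjc (h x y). Proof. by case: hS. Qed.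

Lemma sinn0l z : h 0 z = 0.
Proof. by case: hS => /(_ (-1) 0 0 z) + _ _; rewrite scaler0 addr0 mulN1r addNr. Qed.

Lemma sinnDl x y z : h (x + y) z = h x z + h y z.
Proof. by case: hS => /(_ 1 x y z) + _ _; rewrite scale1r mul1r. Qed.

Lemma sinnZl a x z : h (a *: x) z = a * h x z.
Proof. by case: hS => /(_ a x 0 z) + _ _; rewrite addr0 sinn0l addr0. Qed.

Lemma sinnDr x y z : h x (y + z) = h x y + h x z.
Proof. by rewrite sinn_sym sinnDl rmorphD /= -!sinn_sym. Qed.

Lemma sinnZr a x z : h x (a *: z) = conjc a * h x z.
Proof. by rewrite sinn_sym sinnZl rmorphM /= -sinn_sym. Qed.

Lemma sinn_ge0 x : 0 <= complex.Re (h x x).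
Proof. by apply: Re_ge0; case: hS. Qed.

Lemma sinn_re x : h x x = (complex.Re (h x x))%:C.
Proof. by rewrite RRe_real // ger0_real //; case: hS. Qed.

(** The square of [x - t a y], with [a = h x y] and t real, is a real quadratic in t that is never
    negative; its value at [t = 1 / h y y] is the claim. *)
Lemma sinn_CS x y :
  complex.Re `|h x y| ^+ 2 <= complex.Re (h x x) * complex.Re (h y y).
Proof.
set a := h x y; set n := complex.Re `|a| ^+ 2.
have nE : n%:C = a * conjc a by exact: Re_normr_sqr.
have n0 : 0 <= n by rewrite exprn_ge0 // Re_ge0.
clearbody n.
have H t : 0 <= complex.Re (h x x) - 2 * t * n + t ^+ 2 * n * complex.Re (h y y).
  rewrite -ler0c.
  suff -> : (complex.Re (h x x) - 2 * t * n + t ^+ 2 * n * complex.Re (h y y))%:C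
    = h (x + (- (t%:C * a)) *: y) (x + (- (t%:C * a)) *: y) by case: hS.
  rewrite !(sinnDl, sinnDr, sinnZl, sinnZr) (sinn_sym x y) -/a.
  rewrite conjcNMr.
  rewrite (sinn_re x) (sinn_re y).
  rewrite !(rmorphD, rmorphN, rmorphM, rmorphXn) /= nE.
  ring.
have qy := sinn_ge0 y; have qx := sinn_ge0 x.
have [y0|y0] := eqVneq (complex.Re (h y y)) 0.
  rewrite y0 mulr0 leNgt; apply/negP => np.
  (* Here the quadratic is affine in t, and this t makes it negative. *)
  have := H ((complex.Re (h x x) + 1) / n); rewrite y0 mulr0 addr0.
  rewrite -mulrA divfK ?gt_eqF //; lra.
have yp : 0 < complex.Re (h y y) by rewrite lt_def y0.
rewrite -ler_pdivrMr // -subr_ge0.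
suff -> : complex.Re (h x x) - n / complex.Re (h y y) = complex.Re (h x x)
  - 2 * (complex.Re (h y y))^-1 * n
  + (complex.Re (h y y))^-1 ^+ 2 * n * complex.Re (h y y) by exact: H.
by field; rewrite y0.
Qed.

End SemiInner.

(** * Roots of unity *)

Lemma prim_root_exists {F : closedFieldType} {n : nat} :
  n%:R != 0 :> F -> exists z : F, n.-primitive_root z.
Proof.
move=> n0; have n_gt0 : (0 < n)%N by case: n n0 => //; rewrite eqxx.
have [r] := closed_field_poly_normal ('X^n - 1 : {poly F}).
rewrite (monicP (monicXnsubC 1 n_gt0)) scale1r => rE.
(* As n is nonzero in F, [X^n - 1] has n distinct roots, and among n distinct n-th roots of unity
   one is primitive. *)
have ur : uniq r by rewrite -separable_prod_XsubC -rE separable_Xn_sub_1.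
have sr : (n <= size r)%N.
  by rewrite -ltnS -(size_prod_XsubC r id) -rE size_XnsubC.
have r1 : all n.-unity_root r.
  by apply/allP => z zr; rewrite /root_of_unity rE root_prod_XsubC.
by have /hasP[z _ zP] := has_prim_root n_gt0 r1 ur sr; exists z.
Qed.

Lemma prim_root_sum {F : fieldType} {n : nat} {z : F} (l : nat) :
  n.-primitive_root z -> (0 < l < n)%N -> \sum_(j < n) z ^+ j ^+ l = 0.
Proof.
move=> pz /andP[l0 ln].
have zl : z ^+ l - 1 != 0.
  by rewrite subr_eq0 -(prim_order_dvd pz) gtnNdvd.
apply: (mulfI zl); rewrite mulr0.
under eq_bigr do rewrite -exprM mulnC exprM.
by rewrite -subrX1 -exprM mulnC exprM (prim_expr_order pz) expr1n subrr.
Qed.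

(** * The power inequality for a semi-inner product *)

Section PowerInequality.
Set Implicit Arguments.
Unset Strict Implicit.
Variables (C : numClosedFieldType) (V : lmodType C) (h : V -> V -> C).
Hypothesis hl : forall a x y z, h (a *: x + y) z = a * h x z + h y z.
Hypothesis hr : forall x y z, h z (x + y) = h z x + h z y.
Hypothesis h_ge0 : forall x, 0 <= h x x.

Let h0l z : h 0 z = 0.
Proof. by have := hl (-1) 0 0 z; rewrite scaler0 addr0 mulN1r addNr. Qed.

Let hZl a x z : h (a *: x) z = a * h x z.
Proof. by have := hl a x 0 z; rewrite addr0 h0l addr0. Qed.

Let hBl x y z : h (x - y) z = h x z - h y z.
Proof. by rewrite addrC -scaleN1r hl mulN1r addrC. Qed.

Let h0r z : h z 0 = 0.
Proof. by apply/(addrI (h z 0)); rewrite -hr !addr0. Qed.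

(* The vectors [m^-1 \sum_l w^l T^l x], with w ranging over the m-th roots of
   unity, add up to x and satisfy (1 - w T) X_w = m^-1 (1 - T^m) x. *)
Lemma numerical_contraction_iter (T : {linear V -> V}) (m : nat) : (0 < m)%N ->
  (forall x, `|h (T x) x| <= h x x) ->
  forall x, 'Re (h (iter m T x) x) <= h x x.
Proof.
move=> m0 hT x.
have mn0 : m%:R != 0 :> C by rewrite pnatr_eq0 -lt0n.
have [z pz] := prim_root_exists mn0.
pose X (j : 'I_m) := m%:R^-1 *: \sum_(l < m) z ^+ j ^+ l *: iter l T x.
have sumX : \sum_j X j = x.
  rewrite -scaler_sumr exchange_big /= (bigD1 (Ordinal m0)) //=.
  rewrite [X in _ + X]big1 ?addr0; last first.
    move=> l l0; rewrite -scaler_suml prim_root_sum ?scale0r //.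
    by rewrite ltn_ord lt0n andbT; apply: contra l0 => /eqP l0; apply/eqP/val_inj.
  under eq_bigr do rewrite expr0 scale1r.
  by rewrite sumr_const card_ord -[x *+ m]scaler_nat scalerA mulVf // scale1r.
have zjm (j : nat) : z ^+ j ^+ m = 1.
  by rewrite -exprM mulnC exprM (prim_expr_order pz) expr1n.
have TZ a u : T (a *: u) = a *: T u by exact: linearZ_LR.
have telX j : X j - z ^+ j *: T (X j) = m%:R^-1 *: (x - iter m T x).
  rewrite /X TZ scalerA mulrC -scalerA -scalerBr; congr (_ *: _).
  rewrite linear_sum scaler_sumr -sumrB.
  under eq_bigr => l _ do rewrite TZ scalerA -exprS -iterS.
  rewrite -(big_mkord xpredT (fun l => z ^+ j ^+ l *: iter l T x -
     z ^+ j ^+ l.+1 *: iter l.+1 T x)).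
  rewrite (eq_bigr (fun l => - (z ^+ j ^+ l.+1 *: iter l.+1 T x -
     z ^+ j ^+ l *: iter l T x))); last by move=> l _; rewrite opprB.
  by rewrite sumrN telescope_sumr // opprB zjm expr0 !scale1r.
have zn (j : nat) : `|z ^+ j| = 1.
  by apply/eqP; rewrite -(pexpr_eq1 m0) ?normr_ge0 // -normrX zjm normr1.
have term j : 0 <= 'Re (h (X j - z ^+ j *: T (X j)) (X j)).
  rewrite hBl (hZl (z ^+ j)) raddfB /= (Creal_ReP _ (ger0_real (h_ge0 _))) subr_ge0.
  apply: le_trans (hT (X j)).
  by rewrite -[X in _ <= X]mul1r -(zn j) -normrM leif_Re_Creal.
have -> : h x x = 'Re (h x x) by rewrite (Creal_ReP _ (ger0_real (h_ge0 _))).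
(* Only the second argument is expanded along the [X j]; in the j-th summand [x - T^m x] is then m
   times the vector of [term j]. *)
rewrite -subr_ge0 -raddfB /= -hBl -[in X in h _ X]sumX.
rewrite (big_morph (h _) (fun a b => hr a b _) (h0r _)) raddf_sum /=.
apply: sumr_ge0 => j _.
have -> : x - iter m T x = m%:R *: (X j - z ^+ j *: T (X j)).
  by rewrite telX scalerA mulfV // scale1r.
rewrite hZl mulr_natl raddfMn mulrn_wge0 //; exact: term.
Qed.

(** Multiplying T by a scalar c of modulus [1 / w] makes it a numerical contraction; the phase of c
    is chosen so that [c^m y] is real and nonnegative, which turns the bound on the real part into
    one on the modulus. *)
Lemma power_inequality (T : {linear V -> V}) (w : C) (m : nat) :
  (0 < m)%N -> 0 < w -> (forall x, `|h (T x) x| <= w * h x x) ->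
  forall x, `|h (iter m T x) x| <= w ^+ m * h x x.
Proof.
move=> m0 w0 hT x; set y := h (iter m T x) x.
have [->|y0] := eqVneq y 0.
  by rewrite normr0 mulr_ge0 // exprn_ge0 // ltW.
pose c := m.-root (`|y| / y) / w.
have cm : c ^+ m = w ^- m * (`|y| / y).
  by rewrite exprMn rootCK // exprVn mulrC.
have cn : `|m.-root (`|y| / y)| = 1.
  apply/eqP; rewrite -(pexpr_eq1 m0) ?normr_ge0 // -normrX rootCK //.
  by rewrite normf_div normr_id divff // normr_eq0.
pose S : {linear V -> V} := c \*: T.
have itS k u : iter k S u = c ^+ k *: iter k T u.
  elim: k => [|k IH]; first by rewrite expr0 scale1r.
  by rewrite !iterS IH linearZ_LR /= scalerA exprSr.
have hS' u : `|h (S u) u| <= h u u.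
  rewrite /= hZl normrM normf_div cn mul1r (gtr0_norm w0).
  by rewrite ler_pdivrMl.
have := numerical_contraction_iter m0 hS' x.
rewrite itS hZl cm -/y -mulrA divfK // (Creal_ReP _ _); last first.
  by rewrite rpredM ?normr_real // rpredV rpredX // gtr0_real.
by rewrite ler_pdivrMl // exprn_gt0.
Qed.

End PowerInequality.

(** * Riesz representation and uniform boundedness *)

Section Hilbert.
Local Open Scope complex_scope.
Set Implicit Arguments.
Unset Strict Implicit.
Variables (R : realType) (H : hilbertType R).
Implicit Types x y z u : H.

Definition rnorm x : R := complex.Re `|x|.

Lemma rnormE x : `|x| = (rnorm x)%:C.
Proof. by rewrite RRe_real // normr_real. Qed.

Lemma rnorm_ge0 x : 0 <= rnorm x.
Proof. exact/Re_ge0. Qed.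

Lemma rnorm0 : rnorm 0 = 0.
Proof. by rewrite /rnorm normr0. Qed.

Lemma rnorm_eq0 x : rnorm x = 0 -> x = 0.
Proof. by move=> x0; apply/normr0_eq0; rewrite rnormE x0. Qed.

Lemma rnormZ (t : R) x : 0 <= t -> rnorm (t%:C *: x) = t * rnorm x.
Proof. by move=> t0; rewrite /rnorm normrZ ger0_norm ?ler0c // cReMr. Qed.

Lemma rnormD x y : rnorm (x + y) <= rnorm x + rnorm y.
Proof. by rewrite -lecR rmorphD /= -!rnormE ler_normD. Qed.

Lemma rnormN x : rnorm (- x) = rnorm x.
Proof. by rewrite /rnorm normrN. Qed.

Lemma semi_inner_inner : semi_inner (@inner R H : H -> H -> R[i]).
Proof.
split=> [a x y z|x y|x].
- by rewrite linearPl.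
- by rewrite (hermitian_subproof y) expr0 mul1r.
- by rewrite innerxx exprn_ge0.
Qed.

Lemma inner_sqr x : complex.Re (inner x x) = rnorm x ^+ 2.
Proof. by rewrite innerxx rnormE -rmorphXn. Qed.

Lemma inner_CS x y : complex.Re `|inner x y| <= rnorm x * rnorm y.
Proof.
rewrite -(ler_pXn2r (n := 2)) ?nnegrE ?mulr_ge0 ?rnorm_ge0 ?Re_ge0 //.
by rewrite exprMn -!inner_sqr; exact: (sinn_CS semi_inner_inner).
Qed.

Lemma hilbert_complete (u : nat -> H) (e : nat -> R) :
  e @ \oo --> (0 : R) ->
  (forall n m, (n <= m)%N -> rnorm (u n - u m) <= e n) ->
  exists l, forall n, rnorm (u n - l) <= e n.
Proof.
move=> e0 ue.
have: cvg (u @ \oo).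
  apply: cauchy_cvg; apply: cauchy_exP => eps eps0.
  have [d dE] : exists d, eps = d%:C by apply/complex_realP; rewrite gtr0_real.
  move: eps0; rewrite dE (ltcR 0) => d0.
  move/cvgrPdist_lt : e0 => /(_ _ d0) [N _ HN].
  exists (u N), N => // n /= Nn; rewrite -ball_normE /= rnormE ltcR.
  apply: le_lt_trans (ue _ _ Nn) _.
  by have := HN N (leqnn N); rewrite sub0r normrN => /(le_lt_trans (ler_norm _)).
move/cvg_ex => [l /cvgrPdist_lt ul]; exists l => n.
apply/ler_addgt0Pr => d d0.
have dC : 0 < d%:C by rewrite (ltcR 0).
have [N _ HN] := ul _ dC.
have := HN (maxn n N) (leq_maxr _ _); rewrite rnormE ltcR => lu.
have -> : u n - l = (u n - u (maxn n N)) - (l - u (maxn n N)).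
  by rewrite opprB addrA subrK.
apply: le_trans (rnormD _ _) _; rewrite rnormN.
by apply: lerD; [apply: ue; rewrite leq_maxl|exact: ltW].
Qed.

Lemma cvg_harmonic_scale (c : R) : (fun n => c * (n.+1%:R)^-1) @ \oo --> (0 : R).
Proof.
rewrite -(mulr0 c); apply: cvgM; [exact: cvg_cst|exact: cvg_harmonic].
Qed.

(** Let x minimise [J] up to [d^2]. Comparing x with [x + t z] gives [- d^2 <= 2 t g + t^2 |z|^2]
    for all real t, and the best t, [- g / |z|^2], yields [g^2 <= d^2 |z|^2]. *)
Lemma riesz_approx (f : H -> R[i]) (M : R) :
  (forall a x y, f (a *: x + y) = a * f x + f y) ->
  (forall x, complex.Re `|f x| <= M * rnorm x) ->
  forall d : R, 0 < d -> exists x, forall z,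
    `|complex.Re (inner z x - f z)| <= d * rnorm z.
Proof.
move=> fl fM d d0.
pose J x := rnorm x ^+ 2 - 2 * complex.Re (f x).
have JM x : - M ^+ 2 <= J x.
  have := le_trans (Re_le_normr _) (fM x); rewrite /J => h.
  have := sqr_ge0 (rnorm x - M); nra.
have hJ : has_inf (range J).
  by split; [exists (J 0), 0|exists (- M ^+ 2) => _ [x _ <-]].
have [_ [x _ <-] Jx] := inf_adherent (exprn_gt0 2 d0) hJ.
exists x => z; set g := complex.Re _.
have Jge t : J x - d ^+ 2 <= J (t%:C *: z + x).
  apply: (@le_trans _ _ (inf (range J))); first by rewrite lerBlDr ltW.
  by apply: ge_inf; [case: hJ|exists (t%:C *: z + x)].
have JE t : J (t%:C *: z + x) = J x + 2 * t * g + t ^+ 2 * rnorm z ^+ 2.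
  rewrite /J /g -!inner_sqr fl cReD cReMr cReB.
  have hS := semi_inner_inner.
  rewrite !(sinnDl hS, sinnDr hS, sinnZl hS, sinnZr hS).
  rewrite (sinn_sym hS z x) conjc_real !(cReD, cReMr).
  have -> : complex.Re (conjc (inner z x)) = complex.Re (inner z x).
    by case: (inner z x).
  ring.
have Jt t : - d ^+ 2 <= 2 * t * g + t ^+ 2 * rnorm z ^+ 2.
  by have := Jge t; rewrite JE; lra.
have [z0|z0] := eqVneq (rnorm z) 0.
  have f0 : f 0 = 0 by have := fl (-1) 0 0; rewrite scaler0 addr0 mulN1r addNr.
  rewrite /g (rnorm_eq0 z0) f0 (sinn0l semi_inner_inner) subrr normr0.
  by rewrite rnorm0 mulr0.
have q0 : 0 < rnorm z ^+ 2 by rewrite exprn_gt0 // lt_def z0 rnorm_ge0.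
rewrite -(ler_pXn2r (n := 2)) ?nnegrE ?mulr_ge0 ?rnorm_ge0 ?(ltW d0) //.
rewrite real_normK ?num_real // exprMn -ler_pdivrMr //.
have := Jt (- g / rnorm z ^+ 2).
have -> : 2 * (- g / rnorm z ^+ 2) * g + (- g / rnorm z ^+ 2) ^+ 2 * rnorm z ^+ 2
  = - (g ^+ 2 / rnorm z ^+ 2) by field.
by rewrite lerN2.
Qed.

(* A minimising sequence of |x|^2 - 2 Re (f x) satisfies the Euler equation of
   the minimum up to an error tending to 0, and this already makes it Cauchy. *)
Theorem riesz (f : H -> R[i]) (M : R) :
  (forall a x y, f (a *: x + y) = a * f x + f y) ->
  (forall x, complex.Re `|f x| <= M * rnorm x) ->
  exists u, forall x, f x = inner x u.
Proof.
move=> fl fM; have hS := semi_inner_inner.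
have d0 (n : nat) : 0 < n.+1%:R^-1 :> R by [].
have [x xP] := choice (fun n => riesz_approx fl fM (d0 n)).
have [u uP] : exists u, forall n, rnorm (x n - u) <= 2 * n.+1%:R^-1.
  apply: hilbert_complete; first exact: cvg_harmonic_scale.
  move=> n m nm; set z := x n - x m.
  have [z0|z0] := eqVneq (rnorm z) 0; first by rewrite z0 mulr_ge0.
  have zp : 0 < rnorm z by rewrite lt_def z0 rnorm_ge0.
  rewrite -(ler_pM2r zp) -expr2 -inner_sqr.
  (* The two Euler errors bound [|z|^2] by [(1/(n+1) + 1/(m+1)) |z|], hence the rate [2/(n+1)]. *)
  have -> : inner z z = (inner z (x n) - f z) - (inner z (x m) - f z).
    by rewrite opprB addrA subrK /z linearBr.
  rewrite cReB; have := xP n z; have := xP m z.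
  rewrite !ler_norml => /andP[am bm] /andP[an bn].
  have : m.+1%:R^-1 <= n.+1%:R^-1 :> R by rewrite lef_pV2 ?posrE // ler_nat.
  move/(ler_wpM2r (ltW zp)); rewrite -mulrA; move: an bn am bm.
  move: (_ * rnorm z) (_ * rnorm z) => dm dn; lra.
have g0 z : complex.Re (inner z u - f z) = 0.
  apply/eqP; rewrite -normr_eq0 -[_ == _]negbK; apply/negP => gp.
  have {}gp : 0 < `|complex.Re (inner z u - f z)| by rewrite lt_def gp normr_ge0.
  (* The 3 is one Euler error of [x N] plus twice that from its distance to u. *)
  have /cvgrPdist_lt/(_ _ gp) [N _ /(_ N (leqnn N))] :=
    cvg_harmonic_scale (3 * rnorm z).
  rewrite sub0r normrN ger0_norm ?mulr_ge0 ?rnorm_ge0 //.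
  apply/negP; rewrite -leNgt.
  have -> : inner z u - f z = (inner z (x N) - f z) - inner z (x N - u).
    by rewrite linearBr /=; ring.
  rewrite cReB; apply: le_trans (ler_normB _ _) _.
  have -> : 3 * rnorm z / N.+1%:R
    = N.+1%:R^-1 * rnorm z + rnorm z * (2 * N.+1%:R^-1) by ring.
  apply: lerD; first exact: xP.
  have : `|complex.Re (inner z (x N - u))| <= complex.Re `|inner z (x N - u)|.
    by rewrite -lecR Re_normr normc_ge_Re.
  move/le_trans; apply; apply: le_trans (inner_CS _ _) _.
  by rewrite ler_wpM2l ?rnorm_ge0.
exists u => z; apply/esym/eqP; rewrite -subr_eq0 eq_complex g0 eqxx /=.
have f0 : f 0 = 0 by have := fl (-1) 0 0; rewrite scaler0 addr0 mulN1r addNr.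
(* The real part at [i z] is minus the imaginary part at z. *)
have := g0 ('i *: z).
have := fl 'i z 0; rewrite !addr0 f0 addr0 => ->.
rewrite (sinnZl hS) -mulrBr mulrC ReiNIm => /eqP.
by rewrite oppr_eq0.
Qed.

(** If v is the multiple of u of norm s, then [2 <v, u> = <x + v, u> - <x - v, u>] has modulus
    [2 s |u|], so [x + v] or [x - v] will do. *)
Lemma hump_step (s : R) x u : 0 <= s ->
  exists x', rnorm (x' - x) <= s /\ s * rnorm u <= complex.Re `|inner x' u|.
Proof.
move=> s0; have [u0|u0] := eqVneq (rnorm u) 0.
  by exists x; rewrite subrr rnorm0 u0 mulr0 s0 Re_ge0.
pose v := (s / rnorm u)%:C *: u.
have su0 : 0 <= s / rnorm u by rewrite divr_ge0 ?rnorm_ge0.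
have vn : rnorm v = s by rewrite /v rnormZ // divfK.
have vu : complex.Re `|inner v u| = s * rnorm u.
  rewrite /v (sinnZl semi_inner_inner) normrM ger0_norm ?ler0c // cReMr.
  rewrite (ger0_norm (_ : 0 <= inner u u)); last by rewrite innerxx exprn_ge0.
  by rewrite inner_sqr expr2 mulrA divfK.
have [h|h] := lerP (s * rnorm u) (complex.Re `|inner (x + v) u|).
  by exists (x + v); rewrite addrC addrA addNr add0r vn.
exists (x - v); split; first by rewrite addrAC subrr add0r rnormN vn.
have vE : 2%:R * inner v u = inner (x + v) u - inner (x - v) u.
  rewrite -[- v]scaleN1r !(sinnDl semi_inner_inner) (sinnZl semi_inner_inner (-1)).
  by ring.
have : 2 * (s * rnorm u)
    <= complex.Re `|inner (x + v) u| + complex.Re `|inner (x - v) u|.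
  rewrite -vu -cReD -cReMr -lecR !RRe_real ?rpredD ?normr_real //; last first.
    by rewrite rpredM ?normr_real //= complex_real.
  rewrite rmorph_nat -[X in X * _](@ger0_norm R[i]) // -normrM vE.
  exact: ler_normB.
lra.
Qed.

(* The gliding hump: otherwise steps x_(n+1) - x_n of norm at most 3^-n produce
   a limit on which the functionals are not bounded. *)
Theorem uniform_boundedness (U : set H) :
  (forall y, exists M : R, forall u, U u -> complex.Re `|inner y u| <= M) ->
  exists M : R, forall u, U u -> rnorm u <= M.
Proof.
move=> pb; apply: contrapT => /forallNP nb.
pose s n : R := 3^-1 ^+ n.
have s0 n : 0 < s n by rewrite exprn_gt0.
have large n : exists v, U v /\ 2 * n%:R / s n < rnorm v.
  apply: contrapT => /forallNP h; apply: (nb (2 * n%:R / s n)) => v Uv.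
  by rewrite leNgt; apply/negP => hv; apply: (h v).
have [u uP] := choice large.
have [g gP] := choice (fun p : nat * H => hump_step p.2 (u p.1) (ltW (s0 p.1))).
pose fix X n := if n is k.+1 then g (k, X k) else 0.
have X1 n : rnorm (X n.+1 - X n) <= s n by case: (gP (n, X n)).
have X2 n : s n * rnorm (u n) <= complex.Re `|inner (X n.+1) (u n)|.
  by case: (gP (n, X n)).
have sS n : s n.+1 = s n / 3 by rewrite /s exprSr.
(* Geometric sum of the steps of ratio 1/3. *)
have Xnm n k : rnorm (X n - X (n + k)%N) <= 3 / 2 * (s n - s (n + k)%N).
  elim: k => [|k IH]; first by rewrite addn0 !subrr rnorm0 mulr0.
  rewrite addnS; have -> : X n - X (n + k).+1 =
     (X n - X (n + k)%N) - (X (n + k).+1 - X (n + k)%N) by rewrite opprB addrA subrK.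
  apply: le_trans (rnormD _ _) _; rewrite rnormN.
  by apply: le_trans (lerD IH (X1 _)) _; rewrite sS; lra.
have [l lP] : exists l, forall n, rnorm (X n - l) <= 3 / 2 * s n.
  apply: hilbert_complete.
    rewrite -(mulr0 (3 / 2)); apply: cvgM; first exact: cvg_cst.
    by apply: cvg_expr; rewrite ger0_norm ?invr_ge0 // invf_lt1 // ltr1n.
  move=> n m nm; rewrite -(subnKC nm); apply: le_trans (Xnm _ _) _.
  by rewrite ler_wpM2l ?divr_ge0 // gerBl ltW.
have [M MP] := pb l.
have [n Mn] : exists n : nat, M <= n%:R.
  by exists (Num.truncn M).+1; rewrite ltW ?truncnS_gt.
have [Uu un] := uP n.
have := MP _ Uu; apply/negP; rewrite -ltNge; apply: le_lt_trans Mn _.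
(* The limit is within [3/2 s (n+1) = s n / 2] of [X (n+1)], so it keeps half of the hump: at least
   [s n |u n| / 2], which exceeds n by [large]. *)
have : complex.Re `|inner (X n.+1) (u n)| <=
    complex.Re `|inner l (u n)| + complex.Re `|inner (X n.+1 - l) (u n)|.
  rewrite -cReD -lecR !RRe_real ?rpredD ?normr_real //.
  by apply: le_trans (ler_normD _ _); rewrite -linearDl addrC subrK.
have := inner_CS (X n.+1 - l) (u n).
have := ler_wpM2r (rnorm_ge0 (u n)) (lP n.+1).
rewrite sS; have := X2 n.
move: un; rewrite ltr_pdivrMr //; nra.
Qed.

End Hilbert.

(** * Growth of log-convex sequences *)

Section LogConvex.
Set Implicit Arguments.
Unset Strict Implicit.
Variable R : realType.

Lemma bernoulli_ineq (a : R) (n : nat) : 0 <= a -> 1 + n%:R * a <= (1 + a) ^+ n.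
Proof.
move=> a0; elim: n => [|n IH]; first by rewrite mul0r addr0.
rewrite exprS -natr1; have n0 : 0 <= n%:R :> R by [].
have := ler_wpM2l (addr_ge0 ler01 a0) IH; nra.
Qed.

(* Log-convexity forces c to grow at least like (c 1 / c 0) ^+ j. *)
Lemma log_convex_le (c : nat -> R) (D L : R) : 0 < L ->
  (forall j, 0 <= c j) -> (forall j, c j.+1 ^+ 2 <= c j * c j.+2) ->
  (forall j, c j <= L ^+ j * D) -> c 1%N <= L * c 0%N.
Proof.
move=> L0 c0 cc cD; rewrite leNgt; apply/negP => c1.
have [z|nz] := eqVneq (c 0%N) 0.
  have := cc 0%N; rewrite z mul0r leNgt exprn_gt0 //.
  by move: c1; rewrite z mulr0.
have p0 : 0 < c 0%N by rewrite lt_def nz c0.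
pose a := c 1%N / (L * c 0%N) - 1.
have a0 : 0 < a by rewrite subr_gt0 ltr_pdivlMr ?mulr_gt0 // mul1r.
have c1E : c 1%N = L * (1 + a) * c 0%N.
  by rewrite /a; field; rewrite nz gt_eqF.
have t0 : 0 < L * (1 + a) by rewrite mulr_gt0 // addr_gt0.
have grow j : 0 < c j /\ L * (1 + a) * c j <= c j.+1.
  elim: j => [|j [pj gj]]; first by rewrite -c1E.
  have pj1 : 0 < c j.+1 by apply: lt_le_trans gj; rewrite mulr_gt0.
  split=> //; rewrite -(ler_pM2l pj); apply: le_trans (cc j).
  by rewrite mulrA (mulrC (c j)) expr2 ler_wpM2r // ltW.
have low j : (L * (1 + a)) ^+ j * c 0%N <= c j.
  elim: j => [|j IH]; first by rewrite mul1r.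
  rewrite exprS -mulrA; apply: le_trans (grow j).2.
  by rewrite ler_wpM2l // ltW.
(* With this n, [D < n a c 0 <= (1 + a)^n c 0] by Bernoulli, while [low] and [cD] force
   [(1 + a)^n c 0 <= D]. *)
pose n := (Num.truncn (D / (a * c 0%N))).+1.
have := le_trans (low n) (cD n).
rewrite exprMn -mulrA ler_pM2l ?exprn_gt0 //.
have := ler_wpM2r (ltW p0) (bernoulli_ineq n (ltW a0)).
have : D < n%:R * (a * c 0%N).
  by rewrite -ltr_pdivrMr ?mulr_gt0 // truncnS_gt.
nra.
Qed.

End LogConvex.

(** * Boundedness for the A-seminorm *)

Section SemiHilbert.
Local Open Scope complex_scope.
Set Implicit Arguments.
Unset Strict Implicit.
Variables (R : realType) (H : hilbertType R).
Implicit Types x y z u : H.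

Lemma innerC x y : inner y x = conjc (inner x y).
Proof. exact: (sinn_sym (@semi_inner_inner R H)). Qed.

Lemma bounded_op_rnorm (T : H -> H) : bounded_op T ->
  exists2 N : R, 0 <= N & forall x, rnorm (T x) <= N * rnorm x.
Proof.
move=> [M MP]; exists `|M|; first exact: normr_ge0.
move=> x; rewrite -lecR rmorphM /= -!rnormE; apply: le_trans (MP x) _.
by rewrite ler_wpM2r // lecR ler_norm.
Qed.

(** Riesz, applied to [x |-> inner (T x) y] for each y, shows that [get] chooses from a nonempty set
    rather than returning its default. *)
Lemma adjointP (T : {linear H -> H}) : bounded_op T -> is_adjoint T (adjoint T).
Proof.
move=> /bounded_op_rnorm[N N0 NP].
suff : exists S, is_adjoint T S by move/getPex.
have rz y : exists z, forall x, inner (T x) y = inner x z.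
  apply: (@riesz _ _ _ (N * rnorm y)) => [a u v|x]; first by rewrite linearP linearPl.
  apply: le_trans (inner_CS _ _) _.
  by rewrite mulrAC ler_wpM2r ?rnorm_ge0.
by have [S SP] := choice rz; exists S => x y; exact: SP.
Qed.

(** Use [|S x|^2 = <T (S x), x> <= N |S x| |x|] and cancel [|S x|]. *)
Lemma adjoint_rnorm (T S : H -> H) (N : R) : is_adjoint T S ->
  (forall x, rnorm (T x) <= N * rnorm x) -> forall x, rnorm (S x) <= N * rnorm x.
Proof.
move=> TS NP x; have [z|nz] := eqVneq (rnorm (S x)) 0.
  by rewrite z; apply: le_trans (NP x); exact: rnorm_ge0.
have p : 0 < rnorm (S x) by rewrite lt_def nz rnorm_ge0.
rewrite -(ler_pM2r p) -expr2 -inner_sqr -TS.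
apply: le_trans (Re_le_normr _) _; apply: le_trans (inner_CS _ _) _.
by rewrite mulrAC ler_wpM2r ?rnorm_ge0.
Qed.

Variable A : {linear H -> H}.
Hypothesis hA : positive_op A.

Lemma positive_op_sym x y : inner (A x) y = inner x (A y).
Proof. by case: hA => /adjointP bA AE _; rewrite bA -AE. Qed.

Lemma semi_inner_innerA : semi_inner (innerA A).
Proof.
split=> [a x y z|x y|x]; rewrite /innerA.
- by rewrite linearP linearPl.
- by rewrite positive_op_sym innerC.
- by case: hA.
Qed.

Variable T : {linear H -> H}.
Hypothesis hT : LA A T.

(* X is an A-adjoint of T, possibly neither linear nor bounded. *)
Lemma LA_adjoint : exists X : H -> H,
  (forall y, A (X y) = adjoint T (A y)) /\
  (forall y v, inner y (A (T v)) = inner (X y) (A v)).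
Proof.
case: hT => bT rT; have TS := adjointP bT.
have ex y : exists z, A z = adjoint T (A y).
  by have [z _ zE] := rT _ (ex_intro2 _ _ y I erefl); exists z.
have [X XP] := choice ex; exists X; split=> // y v.
by rewrite -!positive_op_sym XP innerC TS -innerC.
Qed.

Lemma LA_range_bound : exists2 C : R, 0 <= C &
  forall v, rnorm (A (T v)) <= C * rnorm (A v).
Proof.
have [X [_ XP]] := LA_adjoint.
pose U := [set A (T v) | v in [set v | rnorm (A v) <= 1]].
have [y|C CP] := @uniform_boundedness R H U.
  exists (rnorm (X y)) => _ [v v1 <-]; rewrite XP.
  apply: le_trans (inner_CS _ _) _.
  by rewrite -[leRHS]mulr1 ler_wpM2l ?rnorm_ge0.
have C0 : 0 <= C.
  by rewrite -(@rnorm0 R H); apply: CP; exists 0; rewrite /= ?linear0 ?rnorm0.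
exists C => // v; have [z|nz] := eqVneq (rnorm (A v)) 0.
  (* If [A v = 0], testing against [A (T v)] itself gives [|A (T v)|^2 = 0]; normalising v would be
     impossible. *)
  have := XP (A (T v)) v; rewrite (rnorm_eq0 z) linear0r.
  rewrite innerxx => /eqP; rewrite expf_eq0 /= normr_eq0 => /eqP->.
  by rewrite !rnorm0 mulr0.
have p : 0 < rnorm (A v) by rewrite lt_def nz rnorm_ge0.
have pi : 0 <= (rnorm (A v))^-1 by rewrite invr_ge0 ltW.
rewrite mulrC -ler_pdivrMl // -rnormZ // -!linearZ_LR.
by apply: CP; eexists; last reflexivity; rewrite /= linearZ_LR rnormZ // mulVf.
Qed.

(* With S := X T, the sequence |S^j x|_A^2 is log-convex and grows at most
   geometrically in j, at a rate that does not depend on x. *)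
Lemma LA_seminorm_bound : exists2 K : R, 0 <= K & forall x,
  complex.Re (innerA A (T x) (T x)) <= K * complex.Re (innerA A x x).
Proof.
have hS := semi_inner_innerA.
have [X [XP _]] := LA_adjoint.
have [C C0 CP] := LA_range_bound.
have [bT _] := hT; have [N N0 NP] := bounded_op_rnorm bT.
have TS := adjointP bT.
have TsN := adjoint_rnorm TS NP.
(* [N * C] bounds S for the seminorm [|A .|], since [A S = T^* A T]; adding 1 makes the rate
   positive. *)
pose L := N * C + 1.
have L0 : 0 < L by rewrite ltr_wpDl // mulr_ge0.
exists L; first exact: ltW.
pose S := X \o T.
have SL x : rnorm (A (S x)) <= L * rnorm (A x).
  rewrite /S /= XP; apply: le_trans (TsN _) _.
  have := ler_wpM2l N0 (CP x); have := rnorm_ge0 (A x); rewrite /L; nra.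
have ST x y : innerA A (S x) y = innerA A (T x) (T y).
  by rewrite /innerA /S /= XP innerC -TS -innerC.
have Ssym x y : innerA A (S x) y = innerA A x (S y).
  by rewrite ST (sinn_sym hS (S y)) ST -(sinn_sym hS).
have Ssymj j x y : innerA A (iter j S x) y = innerA A x (iter j S y).
  by elim: j x y => // j IH x y; rewrite iterS Ssym IH -iterSr.
have SLj j x : rnorm (A (iter j S x)) <= L ^+ j * rnorm (A x).
  elim: j => [|j IH]; first by rewrite mul1r.
  rewrite iterS exprS -mulrA; apply: le_trans (SL _) _.
  by rewrite ler_wpM2l // ltW.
move=> x; pose c j := complex.Re (innerA A (iter j S x) (iter j S x)).
have c0 j : 0 <= c j := sinn_ge0 hS _.
have CS u v : complex.Re (innerA A u u) * complex.Re (innerA A v v) >=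
   complex.Re `|innerA A u v| ^+ 2 := sinn_CS hS u v.
have cS : c 1%N <= L ^+ 2 * c 0%N.
  apply: (@log_convex_le _ c (rnorm (A x) * rnorm x)) => // [|j|j].
  - by rewrite exprn_gt0.
  (* By symmetry one S moves across: [c (j+1)] is the real part of [<S^j x, S^(j+2) x>_A]. *)
  - apply: le_trans (CS (iter j S x) (iter j.+2 S x)).
    rewrite ler_pXn2r ?nnegrE ?Re_ge0 //; last by case: hS.
    by rewrite [iter j.+2 _ _]iterS -Ssym -iterS Re_le_normr.
  (* All factors move to the left, [c j = Re <A S^(2j) x, x>], so the rate is [L^2]. *)
  - rewrite /c Ssymj -iterD addnn -mul2n -Ssymj.
    apply: le_trans (Re_le_normr _) _; apply: le_trans (inner_CS _ _) _.
    by rewrite mulrA ler_wpM2r ?rnorm_ge0 // -exprM SLj.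
have Tx0 : 0 <= complex.Re (innerA A (T x) (T x)) := sinn_ge0 hS _.
have x0 : 0 <= complex.Re (innerA A x x) := c0 0%N.
rewrite -(ler_pXn2r (n := 2)) ?nnegrE ?mulr_ge0 ?(ltW L0) //.
(* Since [|T x|_A^2 = <S x, x>_A], Cauchy-Schwarz bounds its square by [c 1 * c 0]. *)
rewrite exprMn; apply: (@le_trans _ _ (c 1%N * c 0%N)).
  apply: le_trans (CS (S x) x); rewrite ler_pXn2r ?nnegrE ?Re_ge0 //; last by case: hS.
  by rewrite -ST Re_le_normr.
by rewrite [X in _ <= _ * X]expr2 mulrA ler_wpM2r //; exact: (c0 0%N).
Qed.

End SemiHilbert.

(** * The A-numerical radius as a bound on the quadratic form *)

Section NumericalRadius.
Local Open Scope complex_scope.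
Set Implicit Arguments.
Unset Strict Implicit.
Variables (R : realType) (H : hilbertType R).

Section Form.
Variables (A T : H -> H).
Hypothesis hS : semi_inner (innerA A).

Lemma wA_le (M : R) : 0 <= M ->
  (forall x, complex.Re `|innerA A (T x) x| <= M * complex.Re (innerA A x x)) ->
  wA A T <= M.
Proof.
move=> M0 TM; rewrite /wA; set E := [set _ | _ in _].
(* Without vectors of A-norm 1 the supremum is 0, and [M0] suffices. *)
have [[e Ee]|/nonemptyPn ->] := pselect (E !=set0); last by rewrite sup0.
apply: ge_sup; first by exists e.
move=> _ [x x1 <-]; apply: le_trans (TM x) _.
rewrite -[X in _ <= X]mulr1 ler_wpM2l //.
by rewrite -[complex.Re _]sqr_sqrtr ?(sinn_ge0 hS) // [Num.sqrt _]x1 expr1n.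
Qed.

Lemma wA_ge0 : 0 <= wA A T.
Proof.
(* A set that is empty or unbounded above has [sup] equal to 0 by convention. *)
have [/sup_out h|/contrapT[[e Ee] ubE]] := pselect (~ has_sup
    [set complex.Re `|innerA A (T x) x| | x in [set x | normA A x = 1]]).
  by rewrite /wA h.
apply: (@le_trans _ _ e); first by case: Ee => x _ <-; exact: Re_ge0.
exact: ub_le_sup.
Qed.

(** The bound by K makes the supremum finite, so scaling to A-norm 1 applies; it also makes the form
    vanish at vectors of A-norm 0, which cannot be scaled. *)
Lemma wA_form (K : R) :
  (forall a x, T (a *: x) = a *: T x) ->
  (forall x y, complex.Re `|innerA A (T x) y| ^+ 2 <=
     K * complex.Re (innerA A x x) * complex.Re (innerA A y y)) ->
  forall x, complex.Re `|innerA A (T x) x| <= wA A T * complex.Re (innerA A x x).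
Proof.
move=> TZ TK x; have x0 := sinn_ge0 hS x.
have [z|nz] := eqVneq (complex.Re (innerA A x x)) 0.
  have := TK x x; rewrite z !mulr0 => h.
  by rewrite -(ler_pXn2r (n := 2)) ?nnegrE ?Re_ge0 // expr0n.
have p : 0 < complex.Re (innerA A x x) by rewrite lt_def nz.
pose s := Num.sqrt (complex.Re (innerA A x x)).
have s0 : 0 < s by rewrite sqrtr_gt0.
have s2 : s ^+ 2 = complex.Re (innerA A x x) by rewrite sqr_sqrtr.
have sV u v : innerA A (s^-1%:C *: u) (s^-1%:C *: v) = (s ^- 2)%:C * innerA A u v.
  rewrite (sinnZl hS) (sinnZr hS) conjc_real mulrA -rmorphM -exprVn expr2 //.
have ubE : has_ubound
    [set complex.Re `|innerA A (T x) x| | x in [set x | normA A x = 1]].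
  exists (1 + `|K|) => _ [y y1 <-].
  have yy : complex.Re (innerA A y y) = 1.
    by rewrite -[LHS]sqr_sqrtr ?(sinn_ge0 hS) // [Num.sqrt _]y1 expr1n.
  have := TK y y; rewrite yy !mulr1.
  have := ler_norm K; have := normr_ge0 K; nra.
rewrite -s2 -ler_pdivrMr ?exprn_gt0 //.
apply: ub_le_sup => //; exists (s^-1%:C *: x).
  rewrite /= /normA sV cReMr -s2 mulVf ?sqrtr1 // expf_neq0 // gt_eqF //.
rewrite TZ sV normrM ger0_norm ?cReMr 1?mulrC //.
by rewrite ler0c invr_ge0 exprn_ge0 // ltW.
Qed.

End Form.

(** A strict bound w is used because [wA A T] may be 0, while [power_inequality] divides by w. *)
Lemma wA_power (A T : {linear H -> H}) (K w : R) (m : nat) :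
  semi_inner (innerA A) ->
  (forall x y, complex.Re `|innerA A (T x) y| ^+ 2 <=
     K * complex.Re (innerA A x x) * complex.Re (innerA A y y)) ->
  (0 < m)%N -> wA A T < w ->
  forall x, complex.Re `|innerA A (iter m T x) x|
    <= w ^+ m * complex.Re (innerA A x x).
Proof.
move=> hS TK m0 wT x.
have w0 : 0 < w by apply: le_lt_trans wT; exact: wA_ge0.
rewrite -lecR Re_normr rmorphM rmorphXn /= -(sinn_re hS).
apply: (@power_inequality R[i] H (innerA A) _ _ _ T w%:C m) => //.
- by case: hS.
- by move=> u v z; exact: sinnDr.
- by case: hS.
- by rewrite (ltcR 0).
move=> u; rewrite -Re_normr (sinn_re hS) -rmorphM lecR.
have := wA_form hS (K := K) (linearZ_LR T) TK u.
by move/le_trans; apply; rewrite ler_wpM2r ?(sinn_ge0 hS) // ltW.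
Qed.

End NumericalRadius.

(** * Block operators on the direct sum *)

Section OffDiagonal.
Local Open Scope complex_scope.
Set Implicit Arguments.
Unset Strict Implicit.
Variables (R : realType) (H : hilbertType R).
Variables (A T2 T3 : {linear H -> H}).

Local Notation AA := (opmx A \0 \0 A).
Local Notation TT := (opmx \0 T2 T3 \0).

Lemma opmx_diagE (x : hsum H H) : AA x = (A x.1, A x.2).
Proof. by rewrite /opmx /= addr0 add0r. Qed.

Lemma opmx_antidiagE (x : hsum H H) : TT x = (T2 x.2, T3 x.1).
Proof. by rewrite /opmx /= addr0 add0r. Qed.

Lemma innerA_diag (x y : hsum H H) :
  innerA AA x y = innerA A x.1 y.1 + innerA A x.2 y.2.
Proof. by rewrite /innerA opmx_diagE. Qed.

Lemma opmx_diag_linear : linear AA.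
Proof. by move=> a x y; rewrite !opmx_diagE /= !linearP. Qed.

Lemma opmx_antidiag_linear : linear TT.
Proof. by move=> a x y; rewrite !opmx_antidiagE /= !linearP. Qed.

Lemma semi_inner_diag : semi_inner (innerA A) -> semi_inner (innerA AA).
Proof.
move=> hS; split=> [a x y z|x y|x]; rewrite !innerA_diag.
- by rewrite /= !(sinnDl hS) !(sinnZl hS); ring.
- by rewrite (sinn_sym hS x.1) (sinn_sym hS x.2) rmorphD.
- by case: hS => _ _ h; rewrite addr_ge0.
Qed.

Lemma iter_antidiag n (x : hsum H H) :
  iter (2 * n) TT x = (iter n (T2 \o T3) x.1, iter n (T3 \o T2) x.2).
Proof.
elim: n => [|n IH]; first by case: x.
by rewrite mulnS !iterS IH !opmx_antidiagE.
Qed.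

End OffDiagonal.

Theorem theorem3p4 (R : realType) (H : hilbertType R)
    (A : {linear H -> H}) (hA : positive_op A)
    (T2 T3 : {linear H -> H}) (hT2 : LA A T2) (hT3 : LA A T3)
    (n : nat) (hn : (1 <= n)%N) :
  wA (opmx A \0 \0 A) (opmx \0 T2 T3 \0) >=
  (Num.max (wA A (iter n (T2 \o T3))) (wA A (iter n (T3 \o T2))))
    `^ ((2 * n)%:R^-1).
Proof.
have hS := semi_inner_innerA hA.
have hSS := semi_inner_diag hS.
have [K2 K20 T2K] := LA_seminorm_bound hA hT2.
have [K3 K30 T3K] := LA_seminorm_bound hA hT3.
have TK x y : complex.Re `|innerA (opmx A \0 \0 A) (opmx \0 T2 T3 \0 x) y| ^+ 2
    <= (K2 + K3) * complex.Re (innerA (opmx A \0 \0 A) x x)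
      * complex.Re (innerA (opmx A \0 \0 A) y y).
  apply: le_trans (sinn_CS hSS _ _) _.
  rewrite ler_wpM2r ?(sinn_ge0 hSS) //.
  rewrite opmx_antidiagE !innerA_diag /= !cReD.
  have := T2K x.2; have := T3K x.1.
  have := sinn_ge0 hS x.1; have := sinn_ge0 hS x.2; nra.
pose AA : {linear hsum H H -> hsum H H} :=
  HB.pack (opmx A \0 \0 A) (GRing.isLinear.Build _ _ _ _ _ (opmx_diag_linear A)).
pose TT : {linear hsum H H -> hsum H H} := HB.pack (opmx \0 T2 T3 \0)
  (GRing.isLinear.Build _ _ _ _ _ (opmx_antidiag_linear T2 T3)).
(* The slack e supplies the strict bound for [wA_power]. *)
apply/ler_addgt0Pr => e e0; set W := (X in _ <= X + e).
have n2 : (0 < 2 * n)%N by rewrite muln_gt0.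
have We : wA AA TT < W + e by rewrite ltrDl.
have W0 : 0 <= W + e by apply: ltW; apply: le_lt_trans We; exact: wA_ge0.
have pw := @wA_power _ _ AA TT _ _ _ hSS TK n2 We.
have le2 : wA A (iter n (T2 \o T3)) <= (W + e) ^+ (2 * n).
  apply: (wA_le hS); first exact: exprn_ge0.
  (* On vectors with one zero component the form of the 2n-th iterate reduces to that of a single
     block. *)
  move=> x; have := pw (x, 0).
  by rewrite iter_antidiag !innerA_diag /= (sinn_sym hS 0) !(sinn0l hS) conjc0 !addr0.
have le3 : wA A (iter n (T3 \o T2)) <= (W + e) ^+ (2 * n).
  apply: (wA_le hS); first exact: exprn_ge0.
  move=> x; have := pw (0, x).
  by rewrite iter_antidiag !innerA_diag /= (sinn_sym hS 0) !(sinn0l hS) conjc0 !add0r.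
have -> : W + e = ((W + e) ^+ (2 * n)) `^ (2 * n)%:R^-1.
  by rewrite -powR_mulrn // -powRrM mulfV ?powRr1 // pnatr_eq0 -lt0n.
apply: ge0_ler_powR; rewrite ?invr_ge0 // ?nnegrE ?exprn_ge0 //.
- by rewrite le_max wA_ge0.
- by rewrite ge_max le2 le3.
Qed.
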